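(* Let $X$ be a set and let $\varepsilon$ be the equation $\bigwedge_{i=1}^n t_i\le\bigvee_{j=1}^m s_j$, where $s_j,t_i\in F_m(X)$ for $1\le i\le n$, $1\le j\le m$. Then $\varepsilon$ is valid in all distributive $\ell$-monoids if and only if there is no right order $\le$ on the free monoid $\mathbf{F}_m(X)$ satisfying $s_j<t_i$ for $1\le i\le n$, $1\le j\le m$.
   Context: $\mathbf{F}_m(X)$ (with universe $F_m(X)$) denotes the free monoid over $X$; its elements are also regarded as monoid terms over $X$. A right order on a monoid $\mathbf{M}$ is a total order $\le$ on $M$ such that $a\le b$ implies $ac\le bc$ for all $a,b,c\in M$. A distributive $\ell$-monoid is an algebraic structure $\langle M,\wedge,\vee,\cdot,\mathrm{e}\rangle$ such that $\langle M,\cdot,\mathrm{e}\rangle$ is a monoid, $\langle M,\wedge,\vee\rangle$ is a distributive lattice, and for all $a,b,c,d\in M$, $a(b\vee c)d=abd\vee acd$ and $a(b\wedge c)d=abd\wedge acd$. For terms $s,t$, $s\le t$ abbreviates the equation $s\wedge t\approx s$. *)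

(* Defs.v *)
From HB Require Import structures.
From mathcomp Require Import all_boot all_order.
From mathcomp Require Import boolp.

Set Implicit Arguments.
Unset Strict Implicit.
Unset Printing Implicit Defensive.

Local Open Scope order_scope.
Local Open Scope group_scope.

(* The carrier is a monoid and a distributive lattice independently (no
   [Order.le] compatibility is assumed); the two laws below are the only link. *)
HB.mixin Record isDistrLMonoid (d : Order.disp_t) M
    of Order.DistrLattice d M & Monoid M := {
  mul_joinlr : forall a b c e : M,
    a * Order.join b c * e = Order.join (a * b * e) (a * c * e);
  mul_meetlr : forall a b c e : M,
    a * Order.meet b c * e = Order.meet (a * b * e) (a * c * e)
}.

#[short(type="distrLMonoidType")]
HB.structure Definition DistrLMonoid (d : Order.disp_t) :=
  { M of isDistrLMonoid d M & Order.DistrLattice d M & Monoid M }.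

(* The free monoid over an arbitrary type: words under concatenation.  The
   equality and choice structures required by [monoidType] are the classical
   ones, so that nothing is demanded of X. *)
Definition free_monoid (X : Type) : Type := seq X.

HB.instance Definition _ (X : Type) := gen_eqMixin (free_monoid X).
HB.instance Definition _ (X : Type) := gen_choiceMixin (free_monoid X).
HB.instance Definition _ (X : Type) :=
  isMonoid.Build (free_monoid X) (@catA X) (@cat0s X) (@cats0 X).

Definition right_order (M : monoidType) (le : rel M) : Prop :=
  [/\ reflexive le, antisymmetric le, transitive le, total le
    & forall a b c : M, le a b -> le (a * c) (b * c)].

Definition strict (M : eqType) (le : rel M) : rel M :=
  fun a b => (a != b) && le a b.

Inductive lm_term (X : Type) : Type :=
  | TVar of X
  | TOne
  | TMul of lm_term X & lm_term X
  | TMeet of lm_term X & lm_term X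
  | TJoin of lm_term X & lm_term X.

Arguments TOne {X}.

Fixpoint lm_eval (X : Type) (d : Order.disp_t) (L : distrLMonoidType d)
    (h : X -> L) (u : lm_term X) : L :=
  match u with
  | TVar x => h x
  | TOne => 1
  | TMul u1 u2 => lm_eval h u1 * lm_eval h u2
  | TMeet u1 u2 => Order.meet (lm_eval h u1) (lm_eval h u2)
  | TJoin u1 u2 => Order.join (lm_eval h u1) (lm_eval h u2)
  end.

(* An equation is a pair of terms. *)
Definition lm_equation (X : Type) : Type := (lm_term X * lm_term X)%type.

Definition lm_valid (X : Type) (eqn : lm_equation X) : Prop :=
  forall (d : Order.disp_t) (L : distrLMonoidType d) (h : X -> L),
    lm_eval h eqn.1 = lm_eval h eqn.2.

Definition lm_le (X : Type) (u v : lm_term X) : lm_equation X :=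
  (TMeet u v, u).

Definition word_term (X : Type) (w : free_monoid X) : lm_term X :=
  foldr (fun x u => TMul (TVar x) u) TOne w.

(* Lattice terms have no empty meet or join, hence the index type 'I_n.+1;
   the bracketing is u_0 . (u_1 . (... . u_n)). *)
Fixpoint big_term (X : Type) (op : lm_term X -> lm_term X -> lm_term X)
    (n : nat) : ('I_n.+1 -> lm_term X) -> lm_term X :=
  match n with
  | 0 => fun u => u ord0
  | n'.+1 => fun u => op (u ord0) (big_term op (fun i => u (lift ord0 i)))
  end.

Definition big_meet (X : Type) (n : nat) (u : 'I_n.+1 -> lm_term X) :
  lm_term X := big_term (@TMeet X) u.

Definition big_join (X : Type) (n : nat) (u : 'I_n.+1 -> lm_term X) :
  lm_term X := big_term (@TJoin X) u.

(* Main.v *)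
Require Import Defs.
From mathcomp Require Import all_boot.
From HB Require Import structures.
From mathcomp Require Import all_order boolp classical_sets wochoice.

Set Implicit Arguments.
Unset Strict Implicit.
Unset Printing Implicit Defensive.

Import Order.TTheory.
Local Open Scope order_scope.
Local Open Scope group_scope.

(** Write val for the evaluation of words in a distributive l-monoid.

    A right order on words refutes the equation.  For any chain T the monotone
    maps T -> T form a distributive l-monoid under composition and the pointwise
    lattice operations; distributivity of the product over meets and joins holds
    because a monotone map of a chain preserves minima and maxima.  If the words
    are ordered by [le], compatibly with right multiplication, then sending each
    letter to right multiplication by it evaluates a word u to the map
    v |-> v * u, which takes the empty word to u.  At the empty word the meet of
    the t_i is thus one of the t_i and the join of the s_j is one of the s_j, so
    validity gives some t_i <= s_j, against s_j < t_i
    ([strict_right_order_refutes]).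

    Conversely, let the equation fail in L.  A prime filter F of L contains the
    value of the meet, hence every val (t_i), and omits the value of the join,
    hence every val (s_j).  Put u <= v when u * w \in F implies v * w \in F for
    all w.  This is visibly a preorder compatible with right multiplication.  It
    is total because every distributive l-monoid satisfies
      u w /\ v z <= u z \/ v w
    ([distrLMonoid_exchange]) and F is prime ([filter_preorder_total]).  Taking
    w = 1 shows that t_i <= s_j fails, so s_j lies strictly below t_i in the
    preorder.

    It remains to refine a total right preorder on words to a right order
    ([right_order_refinement]).  Breaking ties by a fixed right order does not
    work: u may lie strictly below v while u w and v w are tied, and then u w has
    to be put below v w.  The tie between u x and v y is therefore broken by the
    last letters x and y, and if these agree by comparing u and v, recursively.
    A tie between u w and v w is thus passed down the common suffix w, at the
    latest to the comparison of u and v, and the result is antisymmetric because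
    a tie that persists to the end has compared all letters. *)

(** * Evaluation of terms *)

Section Evaluation.
Variables (X : Type) (d : Order.disp_t) (L : distrLMonoidType d) (h : X -> L).

Lemma lm_eval_word_cat (u v : free_monoid X) :
  lm_eval h (word_term (u ++ v)) =
  lm_eval h (word_term u) * lm_eval h (word_term v).
Proof. by elim: u => [|x u IHu] /=; rewrite ?mul1g // IHu mulgA. Qed.

Lemma lm_eval_big_meet_le n (u : 'I_n.+1 -> lm_term X) i :
  (lm_eval h (big_meet u) <= lm_eval h (u i))%O.
Proof.
rewrite /big_meet; elim: n u i => [|n IHn] u i /=; first by rewrite (ord1 i).
case: (unliftP ord0 i) => [j ->|->]; last exact: leIl.
exact: le_trans (leIr _ _) (IHn (fun k => u (lift ord0 k)) j).
Qed.

Lemma lm_eval_big_join_ge n (u : 'I_n.+1 -> lm_term X) i :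
  (lm_eval h (u i) <= lm_eval h (big_join u))%O.
Proof.
rewrite /big_join; elim: n u i => [|n IHn] u i /=; first by rewrite (ord1 i).
case: (unliftP ord0 i) => [j ->|->]; last exact: leUl.
exact: le_trans (IHn (fun k => u (lift ord0 k)) j) (leUr _ _).
Qed.

End Evaluation.

(** * The distributive l-monoid of monotone maps of a chain *)

Section MonotoneMaps.
Variables (d : Order.disp_t) (T : orderType d).

Record monotone_map := MonotoneMap {
  monotone_fun :> T -> T;
  monotone_funP : {homo monotone_fun : x y / (x <= y)%O}
}.

Implicit Types f g : monotone_map.

Lemma monotone_map_ext f g : f =1 g -> f = g.
Proof.
case: f g => [f fP] [g gP] /= /funext eq_fg.
by case: _ / eq_fg in gP *; congr MonotoneMap; apply: Prop_irrelevance.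
Qed.

HB.instance Definition _ := gen_eqMixin monotone_map.
HB.instance Definition _ := gen_choiceMixin monotone_map.

Definition monotone_meet f g : monotone_map :=
  @MonotoneMap (fun x => Order.meet (f x) (g x))
    (fun x y le_xy => leI2 (monotone_funP f le_xy) (monotone_funP g le_xy)).

Definition monotone_join f g : monotone_map :=
  @MonotoneMap (fun x => Order.join (f x) (g x))
    (fun x y le_xy => leU2 (monotone_funP f le_xy) (monotone_funP g le_xy)).

(** Maps compose from left to right, so that a product of maps acts on the right
    of its argument, as right multiplications do. *)
Definition monotone_comp f g : monotone_map :=
  @MonotoneMap (fun x => g (f x))
    (fun x y le_xy => monotone_funP g (monotone_funP f le_xy)).

Definition monotone_id : monotone_map := @MonotoneMap id (fun x y => id).

Fact monotone_meetC : commutative monotone_meet.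
Proof. by move=> f g; apply: monotone_map_ext => x; apply: meetC. Qed.

Fact monotone_joinC : commutative monotone_join.
Proof. by move=> f g; apply: monotone_map_ext => x; apply: joinC. Qed.

Fact monotone_meetA : associative monotone_meet.
Proof. by move=> f g k; apply: monotone_map_ext => x; apply: meetA. Qed.

Fact monotone_joinA : associative monotone_join.
Proof. by move=> f g k; apply: monotone_map_ext => x; apply: joinA. Qed.

Fact monotone_joinKI : forall g f, monotone_meet f (monotone_join f g) = f.
Proof. by move=> g f; apply: monotone_map_ext => x; apply: joinKI. Qed.

Fact monotone_meetKU : forall g f, monotone_join f (monotone_meet f g) = f.
Proof. by move=> g f; apply: monotone_map_ext => x; apply: meetKU. Qed.

Fact monotone_meetUl : left_distributive monotone_meet monotone_join.
Proof. by move=> f g k; apply: monotone_map_ext => x; apply: meetUl. Qed.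

Fact monotone_meetxx : idempotent_op monotone_meet.
Proof. by move=> f; apply: monotone_map_ext => x; apply: meetxx. Qed.

HB.instance Definition _ :=
  @Order.isMeetJoinDistrLattice.Build d monotone_map
    (fun f g => monotone_meet f g == f)
    (fun f g => (g != f) && (monotone_meet f g == f))
    monotone_meet monotone_join (fun f g => erefl) (fun f g => erefl)
    monotone_meetC monotone_joinC monotone_meetA monotone_joinA
    monotone_joinKI monotone_meetKU monotone_meetUl monotone_meetxx.

Fact monotone_compA : associative monotone_comp.
Proof. by move=> f g k; apply: monotone_map_ext. Qed.

Fact monotone_comp1f : left_id monotone_id monotone_comp.
Proof. by move=> f; apply: monotone_map_ext. Qed.

Fact monotone_compf1 : right_id monotone_id monotone_comp.
Proof. by move=> f; apply: monotone_map_ext. Qed.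

HB.instance Definition _ :=
  isMonoid.Build monotone_map
    monotone_compA monotone_comp1f monotone_compf1.

Lemma monotone_map_join f x y :
  f (Order.join x y) = Order.join (f x) (f y).
Proof.
case: (leP x y) => [|/ltW] le_xy; have := monotone_funP f le_xy => le_fxy.
  by rewrite !join_r.
by rewrite !join_l.
Qed.

Lemma monotone_map_meet f x y :
  f (Order.meet x y) = Order.meet (f x) (f y).
Proof.
case: (leP x y) => [|/ltW] le_xy; have := monotone_funP f le_xy => le_fxy.
  by rewrite !meet_l.
by rewrite !meet_r.
Qed.

Fact monotone_mul_joinlr f g k e :
  f * Order.join g k * e = Order.join (f * g * e) (f * k * e) :> monotone_map.
Proof. by apply: monotone_map_ext => x; apply: (monotone_map_join e). Qed.

Fact monotone_mul_meetlr f g k e :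
  f * Order.meet g k * e = Order.meet (f * g * e) (f * k * e) :> monotone_map.
Proof. by apply: monotone_map_ext => x; apply: (monotone_map_meet e). Qed.

HB.instance Definition _ :=
  isDistrLMonoid.Build d monotone_map
    monotone_mul_joinlr monotone_mul_meetlr.

Lemma monotone_map_leP f g :
  reflect (forall x, f x <= g x)%O (f <= g)%O.
Proof.
apply: (iffP eqP) => [<- x|le_fg]; first exact: leIr.
by apply: monotone_map_ext => x; apply/eqP; rewrite -leEmeet le_fg.
Qed.

Section PointwiseEvaluation.
Variables (X : Type) (h : X -> monotone_map).

(** The index depends on [x], but the values of the maps at a point lie in a
    chain, where a finite meet is one of its members. *)
Lemma lm_eval_big_meet_attained n (u : 'I_n.+1 -> lm_term X) x :
  exists i, lm_eval h (big_meet u) x = lm_eval h (u i) x.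
Proof.
rewrite /big_meet; elim: n u => [|n IHn] u /=; first by exists ord0.
have [j Ej] := IHn (fun k => u (lift ord0 k)).
rewrite Ej.
by case: leP => _; [exists ord0 | exists (lift ord0 j)].
Qed.

Lemma lm_eval_big_join_attained n (u : 'I_n.+1 -> lm_term X) x :
  exists i, lm_eval h (big_join u) x = lm_eval h (u i) x.
Proof.
rewrite /big_join; elim: n u => [|n IHn] u /=; first by exists ord0.
have [j Ej] := IHn (fun k => u (lift ord0 k)).
rewrite Ej.
by case: leP => _; [exists (lift ord0 j) | exists ord0].
Qed.

End PointwiseEvaluation.
End MonotoneMaps.

(** * The action of the free monoid on itself *)

Section OrderedWords.
Variables (X : Type) (le : rel (free_monoid X)).
Hypothesis le_right : right_order le.

(** The order is part of the type, so that words acquire a chain structure for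
    each right order separately. *)
Definition ordered_words & right_order le := free_monoid X.

Local Notation W := (ordered_words le_right).

HB.instance Definition _ := Choice.on W.

Fact ordered_words_refl : reflexive (le : rel W).
Proof. by case: le_right. Qed.

Fact ordered_words_anti : antisymmetric (le : rel W).
Proof. by case: le_right. Qed.

Fact ordered_words_trans : transitive (le : rel W).
Proof. by case: le_right. Qed.

HB.instance Definition _ :=
  @Order.Le_isPOrder.Build (Order.Disp tt tt) W le
    ordered_words_refl ordered_words_anti ordered_words_trans.

Fact ordered_words_total : total (<=%O : rel W).
Proof. by case: le_right. Qed.

HB.instance Definition _ :=
  @Order.POrder_isTotal.Build (Order.Disp tt tt) W ordered_words_total.

Definition right_mul (x : X) : monotone_map W.
Proof.
exists (fun w : W => (w : free_monoid X) * ([:: x] : free_monoid X)).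
by case: le_right => _ _ _ _ le_mulr u v; apply: le_mulr.
Defined.

Lemma lm_eval_right_mul (u v : free_monoid X) :
  lm_eval right_mul (word_term u) v = v * u.
Proof.
elim: u v => [|x u IHu] v; first by rewrite /= mulg1.
by rewrite [LHS](IHu (v * ([:: x] : free_monoid X))) -mulgA.
Qed.

(** Evaluate both sides by right multiplications, as maps of words, and compare
    these at the empty word, which a word [u] sends to [u]. *)
Lemma strict_right_order_refutes n m
    (t : 'I_n.+1 -> free_monoid X) (s : 'I_m.+1 -> free_monoid X) :
  (forall i j, strict le (s j) (t i)) ->
  ~ lm_valid (lm_le (big_meet (fun i => word_term (t i)))
                    (big_join (fun j => word_term (s j)))).
Proof.
move=> lt_st /(_ _ _ right_mul) /= /eqP; rewrite -leEmeet.
move/monotone_map_leP/(_ [::]).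
have [i ->] :=
  lm_eval_big_meet_attained right_mul (fun i => word_term (t i)) [::].
have [j ->] :=
  lm_eval_big_join_attained right_mul (fun j => word_term (s j)) [::].
rewrite !lm_eval_right_mul !mul1g => le_ts.
have /andP[/eqP ne_st le_st] := lt_st i j.
by apply: ne_st; apply: ordered_words_anti; apply/andP.
Qed.

End OrderedWords.

(** * Prime filters and right preorders *)

(** A filter maximal among those that contain [a] and omit [b] is prime: if it
    omits [x] and [y], then adjoining either one yields a filter containing [b],
    and by distributivity so does adjoining their join, which therefore is not in
    the filter. *)
Lemma prime_filter_separation (d : Order.disp_t) (L : distrLatticeType d)
    (a b : L) :
  ~~ (a <= b)%O ->
  exists F : L -> Prop,
    [/\ F a /\ ~ F b, forall x y, F x -> (x <= y)%O -> F y,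
        forall x y, F x -> F y -> F (Order.meet x y)
      & forall x y, F (Order.join x y) -> F x \/ F y].
Proof.
move=> /negP not_le_ab.
pose upclosed (F : set L) := forall x y, F x -> (x <= y)%O -> F y.
pose meetclosed (F : set L) := forall x y, F x -> F y -> F (Order.meet x y).
pose P (F : set L) :=
  [/\ forall x, F x -> F a, ~ F b, upclosed F & meetclosed F].
(* The union of the empty chain is empty, so [P] must admit the empty set:
   membership of [a] is required of nonempty sets only, and is recovered from
   maximality. *)
have [C sCP totC|F [[Fa Fb upF meetF] maxF]] := @Zorn_bigcup L P.
  split.
  - move=> x [F CF Fx]; exists F => //.
    by have [Fa _ _ _] := sCP F CF; apply: Fa Fx.
  - by case=> F CF; have [_ ] := sCP F CF.
  - move=> x y [F CF Fx] le_xy; exists F => //.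
    by have [_ _ upF _] := sCP F CF; apply: upF le_xy.
  - move=> x y [F CF Fx] [G CG Gy].
    have [sFG|sGF] := totC F G CF CG.
      exists G => //; have [_ _ _ mG] := sCP G CG.
      by apply: mG => //; apply: sFG.
    exists F => //; have [_ _ _ mF] := sCP F CF.
    by apply: mF => //; apply: sGF.
have {}Fa : F a.
  apply: contrapT => notFa; apply: (maxF (fun y => (a <= y)%O)).
    split=> [|le_aF]; first by move=> x /Fa.
    by apply/notFa/le_aF; apply: lexx.
  split=> // [x y|x y le_ax le_ay]; first exact: le_trans.
  by rewrite lexI le_ax.
(* Otherwise the filter generated by [F] and [x] contradicts maximality. *)
have ext x : ~ F x -> exists2 f, F f & (Order.meet f x <= b)%O.
  move=> notFx; apply: contrapT => noext.
  apply: (maxF (fun y => exists2 f, F f & (Order.meet f x <= y)%O)).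
    split=> [y Fy|sGF]; first by exists y => //; apply: leIl.
    by apply/notFx/sGF; exists a => //; apply: leIr.
  split=> // [y _|y z [f Ff le_fy] le_yz|y z [f Ff le_fy] [g Fg le_gz]].
  - by exists a => //; apply: leIl.
  - by exists f => //; apply: le_trans le_yz.
  - exists (Order.meet f g); first exact: meetF.
    rewrite lexI (le_trans _ le_fy) ?(le_trans _ le_gz) // leI2 ?lexx //.
      exact: leIr.
    exact: leIl.
exists F; split=> // x y Fxy; apply: contrapT.
move=> /not_orP[/ext[f Ff le_f] /ext[g Fg le_g]].
apply/Fb/(upF _ _ (meetF _ _ (meetF _ _ Ff Fg) Fxy)).
rewrite meetUr leUx (le_trans _ le_f) ?(le_trans _ le_g) //.
  by rewrite leI2 ?lexx // leIr.
by rewrite leI2 ?lexx // leIl.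
Qed.

(** In a chain of right actions, either u is below v, and then u w <= v w, or v is
    below u, and then v z <= u z.  Without a chain to argue in, the bound comes
    from expanding (u \/ v) (w /\ z) in the two possible orders. *)
Lemma distrLMonoid_exchange (d : Order.disp_t) (L : distrLMonoidType d)
    (u v w z : L) :
  (Order.meet (u * w) (v * z) <= Order.join (u * z) (v * w))%O.
Proof.
have mulUl x y c : Order.join x y * c = Order.join (x * c) (y * c) :> L.
  by have := mul_joinlr 1 x y c; rewrite !mul1g.
have mulIr c x y : c * Order.meet x y = Order.meet (c * x) (c * y) :> L.
  by have := mul_meetlr c x y 1; rewrite !mulg1.
apply: (@le_trans _ _ (Order.join u v * Order.meet w z)).
  by rewrite mulIr !mulUl leI2 ?leUl ?leUr.
by rewrite mulUl !mulIr leU2 ?leIl ?leIr.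
Qed.

(** Quantifying over [w] turns membership in [F], which alone is the case w = 1,
    into a comparison stable under right multiplication. *)
Definition filter_preorder (M : monoidType) (F : M -> Prop) (u v : M) : Prop :=
  forall w, F (u * w) -> F (v * w).

(** If [w] refutes u <= v and [z] refutes v <= u, then u w and v z lie in [F]
    while u z and v w do not, against the exchange inequality and primality. *)
Lemma filter_preorder_total (d : Order.disp_t) (L : distrLMonoidType d)
    (F : L -> Prop) :
  (forall x y, F x -> (x <= y)%O -> F y) ->
  (forall x y, F x -> F y -> F (Order.meet x y)) ->
  (forall x y, F (Order.join x y) -> F x \/ F y) ->
  forall u v, filter_preorder F u v \/ filter_preorder F v u.
Proof.
move=> upF meetF primeF u v; apply: contrapT.
move=> /not_orP[/existsNP[w /not_implyP[Fuw Fvw]]].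
move=> /existsNP[z /not_implyP[Fvz Fuz]].
have := upF _ _ (meetF _ _ Fuw Fvz) (distrLMonoid_exchange u v w z).
by case/primeF.
Qed.

(** * Refining a right preorder on words to a right order *)

Section LexicographicRefinement.
Variables (X : Type) (leX : X -> X -> Prop) (pre : seq X -> seq X -> Prop).
Hypotheses (leX_refl : forall x, leX x x)
  (leX_anti : forall x y, leX x y -> leX y x -> x = y)
  (leX_trans : forall y x z, leX x y -> leX y z -> leX x z)
  (leX_total : forall x y, leX x y \/ leX y x).
Hypotheses (pre_trans : forall v u w, pre u v -> pre v w -> pre u w)
  (pre_total : forall u v, pre u v \/ pre v u)
  (pre_cons : forall x u v, pre u v -> pre (x :: u) (x :: v)).

(** Words are read backwards here, so that the head of a sequence is the last
    letter of the word and right multiplication by a letter is [cons].  This is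
    the lexicographic comparison of the lists that record, for each suffix of the
    sequence in turn, its class under [pre] and then its head. *)
Fixpoint lexi_le (u v : seq X) : Prop :=
  pre u v /\ (pre v u ->
    match u, v with
    | [::], _ => True
    | _ :: _, [::] => False
    | x :: u', y :: v' => leX x y /\ (leX y x -> lexi_le u' v')
    end).

Lemma lexi_le_pre u v : lexi_le u v -> pre u v.
Proof. by case: u => [|x u] []. Qed.

Lemma lexi_le_total u v : lexi_le u v \/ lexi_le v u.
Proof.
elim: u v => [|x u IHu] [|y v] /=.
- by left; split=> //; case: (pre_total [::] [::]).
- case: (lem (pre [::] (y :: v))) => [le|nle]; first by left.
  by right; case: (pre_total [::] (y :: v)).
- case: (lem (pre [::] (x :: u))) => [le|nle]; first by right.
  by left; case: (pre_total [::] (x :: u)).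
case: (lem (pre (x :: u) (y :: v))) => [le_uv|nle_uv]; last first.
  by right; case: (pre_total (x :: u) (y :: v)).
case: (lem (pre (y :: v) (x :: u))) => [le_vu|nle_vu]; last by left.
case: (lem (leX x y)) => [le_xy|nle_xy]; last first.
  by right; case: (leX_total x y).
case: (lem (leX y x)) => [le_yx|nle_yx]; last by left.
by case: (IHu v) => le'; [left | right].
Qed.

Lemma lexi_le_anti u v : lexi_le u v -> lexi_le v u -> u = v.
Proof.
elim: u v => [|x u IHu] [|y v] //= [le_uv tie_uv] [le_vu tie_vu].
- by case: (tie_vu le_uv).
- by case: (tie_uv le_vu).
have [le_xy le_uv'] := tie_uv le_vu; have [le_yx le_vu'] := tie_vu le_uv.
by rewrite (leX_anti le_xy le_yx) (IHu v) //; auto.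
Qed.

Lemma lexi_le_trans v u w : lexi_le u v -> lexi_le v w -> lexi_le u w.
Proof.
elim: u v w => [|x u IHu] [|y v] [|z w] //= [le_uv tie_uv] [le_vw tie_vw];
  (split=> [|le_wu]; first exact: pre_trans le_uv le_vw);
  have {}tie_uv := tie_uv (pre_trans le_vw le_wu);
  have {}tie_vw := tie_vw (pre_trans le_wu le_uv) => //.
have [[le_xy tie_xy] [le_yz tie_yz]] := (tie_uv, tie_vw).
split=> [|le_zx]; first exact: leX_trans le_xy le_yz.
apply: IHu (tie_xy _) (tie_yz _).
  exact: leX_trans le_yz le_zx.
exact: leX_trans le_zx le_xy.
Qed.

(** When [pre] ties the two longer sequences, their heads agree and the
    comparison of the shorter ones decides. *)
Lemma lexi_le_cons x u v : lexi_le u v -> lexi_le (x :: u) (x :: v).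
Proof. by move=> le_uv; split; first exact/pre_cons/lexi_le_pre. Qed.

End LexicographicRefinement.

Lemma total_order_exists (X : Type) :
  exists leX : X -> X -> Prop,
    [/\ forall x, leX x x, forall x y, leX x y -> leX y x -> x = y,
        forall y x z, leX x y -> leX y z -> leX x z
      & forall x y, leX x y \/ leX y x].
Proof.
have [R wo] := well_ordering_principle {classic X}.
have woT : wo_chain R predT by move=> A _; apply: wo.
have anti x y : R x y -> R y x -> x = y.
  by move=> Rxy Ryx; apply: (wo_chain_antisymmetric woT) => //; apply/andP.
have total x y : R x y || R y x by apply: (wo_chainW woT).
exists R; split=> // [x|y x z Rxy Ryz|x y]; last exact/orP.
  by have := total x x; rewrite orbb.
pose s : seq {classic X} := [:: x; y; z].
(* A well-order is total and antisymmetric; comparing with the least element of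
   {x, y, z} gives transitivity. *)
have [|m [[m_in m_min] _]] := wo [in s].
  by exists x; apply: mem_head.
have [Rmx Rmy Rmz] : [/\ R m x, R m y & R m z].
  by split; apply: m_min; rewrite !inE eqxx ?orbT.
move: m_in; rewrite !inE => /or3P[] /eqP Em; subst m => //.
  by rewrite (anti _ _ Rxy Rmx).
by rewrite -(anti _ _ Ryz Rmy).
Qed.

Lemma right_order_refinement (X : Type)
    (pre : free_monoid X -> free_monoid X -> Prop) :
  (forall v u w, pre u v -> pre v w -> pre u w) ->
  (forall u v, pre u v \/ pre v u) ->
  (forall u v w, pre u v -> pre (u * w) (v * w)) ->
  exists2 le : rel (free_monoid X),
    right_order le & forall u v, ~ pre v u -> strict le u v.
Proof.
move=> pre_trans pre_total pre_mulr.
have [leX [leXxx leX_anti leX_trans leX_total]] := total_order_exists X.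
pose rpre (u v : seq X) := pre (rev u) (rev v).
have rpre_cons x u v : rpre u v -> rpre (x :: u) (x :: v).
  by rewrite /rpre !rev_cons -!cats1; apply: pre_mulr.
have rpre_trans v u w : rpre u v -> rpre v w -> rpre u w by apply: pre_trans.
have rpre_total u v : rpre u v \/ rpre v u by apply: pre_total.
pose le (u v : free_monoid X) := `[< lexi_le leX rpre (rev u) (rev v) >].
have le_total : total le.
  move=> u v; have := lexi_le_total leX_total rpre_total (rev u) (rev v).
  by move=> le_or; apply/orP; case: le_or => ?; [left | right]; apply/asboolP.
exists le.
  split=> // [u|u v|v u w /asboolP le_uv /asboolP le_vw|u v w /asboolP le_uv].
  - by have := le_total u u; rewrite orbb.
  - case/andP=> /asboolP le_uv /asboolP le_vu.
    by apply/(can_inj revK)/(lexi_le_anti leX_anti le_uv le_vu).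
  - exact/asboolP/(lexi_le_trans leX_trans rpre_trans le_uv le_vw).
  - apply/asboolP; rewrite !rev_cat.
    by elim: (rev w) => //= x r; apply: lexi_le_cons.
move=> u v not_pre_vu.
have not_le_vu : ~~ le v u.
  by apply/asboolP => /lexi_le_pre; rewrite /rpre !revK.
have := le_total u v; rewrite (negPf not_le_vu) orbF => le_uv.
apply/andP; split=> //; apply: contraNneq not_le_vu => <-.
by have := le_total u u; rewrite orbb.
Qed.

(** The right preorder of a prime filter separating the values of the two sides,
    pulled back to words along evaluation, puts each [s j] strictly below each
    [t i]. *)
Lemma invalid_equation_right_order (X : Type) (n m : nat)
    (t : 'I_n.+1 -> free_monoid X) (s : 'I_m.+1 -> free_monoid X) :
  ~ lm_valid (lm_le (big_meet (fun i => word_term (t i)))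
                    (big_join (fun j => word_term (s j)))) ->
  exists le : rel (free_monoid X),
    right_order le /\ forall i j, strict le (s j) (t i).
Proof.
move=> /existsNP[d /existsNP[L /existsNP[h /= /eqP]]]; rewrite -leEmeet.
move=> /prime_filter_separation[F [[Fmeet Fjoin] upF meetF primeF]].
pose val (u : free_monoid X) := lm_eval h (word_term u).
pose pre u v := filter_preorder F (val u) (val v).
have [|u v|u v w le_uv c|le le_right ltE] := @right_order_refinement X pre.
- by move=> v u w le_uv le_vw c /le_uv/le_vw.
- exact: filter_preorder_total.
- by rewrite /val !lm_eval_word_cat -!mulgA; apply: le_uv.
exists le; split=> // i j; apply/ltE => /(_ 1); rewrite !mulg1 => Fts.
apply/Fjoin/upF/(lm_eval_big_join_ge h (fun j => word_term (s j)) j)/Fts.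
exact/(upF _ _ Fmeet)/(lm_eval_big_meet_le h (fun i => word_term (t i))).
Qed.

Theorem proposition3p2 (X : Type) (n m : nat)
    (t : 'I_n.+1 -> free_monoid X) (s : 'I_m.+1 -> free_monoid X) :
  lm_valid (lm_le (big_meet (fun i => word_term (t i)))
                  (big_join (fun j => word_term (s j))))
  <->
  ~ (exists le : rel (free_monoid X),
       right_order le /\
       forall (i : 'I_n.+1) (j : 'I_m.+1), strict le (s j) (t i)).
Proof.
split=> [valid [le [le_right lt_st]]|no_order].
  exact: strict_right_order_refutes le_right _ _ _ _ lt_st valid.
by apply: contrapT => /invalid_equation_right_order.
Qed.
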